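(* For $m\ge1$, let $J(m)$ be the number of overpartitions of $m$ in which no part is divisible by $3$. Let $L(m)$ be the number of overpartitions of $m$ with $n$ copies of $n$ such that (i) with parts in ascending lexicographic order, the weighted difference between each part and the preceding one is $\ge0$, and (ii) whenever a maximal block of two or more consecutive parts has all successive weighted differences equal to $0$, only the smallest part of that block (in lexicographic order) may be overlined. Then $J(m)=L(m)$.
   Context: An overpartition of $m$ is a partition of $m$ in which, for each part size, the first occurrence of that part may (or may not) be overlined. $M=\{n_j: 1\le j\le n\}$; a partition with $n$ copies of $n$ is a finite multiset of elements of $M$ whose values (first entries) sum to $m$; an overpartition with $n$ copies of $n$ is such a multiset in which, for each element $n_j$, at most one occurrence may be overlined. Lexicographic order: $m_i>n_j$ iff $m>n$, or $m=n$ and $i>j$. Weighted difference $((m_i-n_j))=m-n-i-j$. *)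

(* Defs.v *)
From mathcomp Require Import all_boot all_order all_algebra.
Set Implicit Arguments. Unset Strict Implicit. Unset Printing Implicit Defensive.
Import Order.TTheory GRing.Theory Num.Theory.

(* ---------- Ordinary overpartitions ----------
   An overpartition of m is encoded by f : part size k (0..m) |->
   (multiplicity of k, whether the first occurrence of k is overlined).
   Multiplicities are at most m since parts are >= 1. *)
Definition ovp (m : nat) := {ffun 'I_m.+1 -> 'I_m.+1 * bool}.

Definition is_overpartition (m : nat) (f : ovp m) : bool :=
  [&& (nat_of_ord (f ord0).1 == 0%N),
      (\sum_(k < m.+1) (k * (f k).1)%N == m)%N &
      [forall k, (f k).2 ==> (0 < (f k).1)%N]].

Definition J (m : nat) : nat :=
  #|[set f : ovp m | is_overpartition f &&
                     [forall k, (0 < (f k).1)%N ==> ~~ (3 %| k)%N]]|.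

(* ---------- Overpartitions with n copies of n ----------
   A part n_j with overline flag b is the triple ((n, j), b).
   Such an overpartition of m is encoded by g : (n, j) |-> (multiplicity of n_j,
   whether one occurrence of n_j is overlined); n, j range over 0..m and only
   pairs with 1 <= j <= n may occur. *)
Definition ovpc (m : nat) := {ffun 'I_m.+1 * 'I_m.+1 -> 'I_m.+1 * bool}.

Definition is_ovp_copies (m : nat) (g : ovpc m) : bool :=
  [&& [forall p, (0 < (g p).1)%N ==> ((1 <= p.2) && (p.2 <= p.1))%N],
      (\sum_(p : 'I_m.+1 * 'I_m.+1) (p.1 * (g p).1)%N == m)%N &
      [forall p, (g p).2 ==> (0 < (g p).1)%N]].

Definition cpart := (nat * nat * bool)%type.

(* The parts of g listed in ascending lexicographic order
   (n_j < m_i iff n < m, or n = m and j < i); an overlined copy of n_j is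
   listed first among the (equal) copies of n_j. *)
Definition parts (m : nat) (g : ovpc m) : seq cpart :=
  flatten [seq (let c := g (inord nj.1, inord nj.2) in
                if nat_of_ord c.1 is k.+1 then (nj, c.2) :: nseq k (nj, false)
                else [::])
          | nj <- [seq (n, j) | n <- iota 1 m, j <- iota 1 n]].

Definition wdiff (b a : cpart) : int :=
  (b.1.1)%:Z - (a.1.1)%:Z - (b.1.2)%:Z - (a.1.2)%:Z.

Definition cp0 : cpart := (0, 0, false)%N.

Definition cond_i (s : seq cpart) : bool :=
  all (fun k => (0 <= wdiff (nth cp0 s k.+1) (nth cp0 s k))%R)
      (iota 0 (size s).-1).

Definition max_zero_block (s : seq cpart) (i j : nat) : bool :=
  [&& (i < j)%N, (j < size s)%N,
      all (fun k => wdiff (nth cp0 s k.+1) (nth cp0 s k) == 0%R) (iota i (j - i)),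
      (i == 0%N) || (wdiff (nth cp0 s i) (nth cp0 s i.-1) != 0%R) &
      (j == (size s).-1) || (wdiff (nth cp0 s j.+1) (nth cp0 s j) != 0%R)].

Definition cond_ii (s : seq cpart) : bool :=
  all (fun i => all (fun j =>
         max_zero_block s i j ==>
         all (fun k => ~~ (nth cp0 s k).2) (iota i.+1 (j - i)))
       (iota 0 (size s))) (iota 0 (size s)).

Definition L (m : nat) : nat :=
  #|[set g : ovpc m | [&& is_ovp_copies g, cond_i (parts g) & cond_ii (parts g)]]|.

(* Main.v *)
Require Import Defs.
From mathcomp Require Import all_boot all_order all_algebra.
From mathcomp Require Import zify ring.
Set Implicit Arguments. Unset Strict Implicit. Unset Printing Implicit Defensive.
Import Order.TTheory GRing.Theory Num.Theory.

(* An admissible list of N parts (n_k)_{j_k} is determined by the subscripts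
   j_k >= 1 and the weighted differences d_k >= 0 (with d_1 = n_1 - j_1), which
   are free, and a part may be overlined unless k > 1 and d_k = 0. Summing over
   them, L has the generating function
     sum_N q^(N^2) (-1; q)_N / ((q; q)_N (q; q^2)_N).
   The Bailey pair
     sum_r (-1)^r q^(r^2 - r) / ((q)_{N-2r} (q)_{N+2r})
       = q^(N(N-1)/2) (-q)_N / (q)_{2N}
   and the limit of the q-Chu-Vandermonde sum turn it into
     (-q)_oo / (q)_oo * sum_r (-1)^r q^(3 r^2),
   and the theta series equals (q^3; q^3)_oo / (-q^3; q^3)_oo by Gauss, which
   leaves the generating function of J. All series are computed modulo q^(m+1),
   that is, in Q[X]/(X^(m+1)): there infinite products are finite ones and every
   1 - c q^k with k >= 1 is a unit. *)

(** * Partitions with n copies of n and their difference codes *)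

Section Codes.
Implicit Types (s : seq cpart) (h : seq cpart).

(* In [admissible], [encode] and [decode], [e] is n' + j' for the part n'_j'
   preceding the list (0 if there is none). The code of a part n_j with flag b
   is the triple (j, d, b), again stored as a [cpart], where d = n - e - j is
   the weighted difference with the preceding part. *)

Fixpoint admissible (fst : bool) (e : nat) s : bool :=
  if s is ((n, j), b) :: s' then
    [&& 0 < j, e + j <= n, (~~ fst && (n == e + j)) ==> ~~ b
      & admissible false (n + j) s']
  else true.

Fixpoint encode (e : nat) s : seq cpart :=
  if s is ((n, j), b) :: s' then ((j, n - (e + j)), b) :: encode (n + j) s'
  else [::].

Fixpoint decode (e : nat) h : seq cpart :=
  if h is ((j, d), b) :: h' then ((e + j + d, j), b) :: decode (e + j + d + j) h'
  else [::].

Fixpoint code_ok (fst : bool) h : bool :=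
  if h is ((j, d), b) :: h' then
    [&& 0 < j, (~~ fst && (d == 0)) ==> ~~ b & code_ok false h']
  else true.

(** Raising [j] by one raises its own part by 1 and every later part by 2; raising [d] by one raises
    this part and every later one by 1. *)
Fixpoint code_weight h : nat :=
  if h is ((j, d), b) :: h' then
    (size h').*2.+1 * j + (size h').+1 * d + code_weight h'
  else 0.

Definition total s := \sum_(x <- s) x.1.1.

Lemma size_encode e s : size (encode e s) = size s.
Proof. by elim: s e => [|[[n j] b] s IHs] e //=; rewrite IHs. Qed.

Lemma encodeK fst e s : admissible fst e s -> decode e (encode e s) = s.
Proof.
elim: s fst e => [|[[n j] b] s IHs] fst e //= /and4P[_ en _ ss].
by rewrite subnKC // (IHs _ _ ss).
Qed.

Lemma decodeK e : cancel (decode e) (encode e).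
Proof.
by move=> h; elim: h e => [|[[j d] b] h IHh] e //=; rewrite IHh addKn.
Qed.

Lemma code_ok_encode fst e s : admissible fst e s -> code_ok fst (encode e s).
Proof.
elim: s fst e => [|[[n j] b] s IHs] fst e //= /and4P[-> en bn /IHs ->].
by rewrite andbT /= subn_eq0 (_ : (n <= _) = (n == e + j)) // eqn_leq en andbT.
Qed.

Lemma admissible_decode fst e h : code_ok fst h -> admissible fst e (decode e h).
Proof.
elim: h fst e => [|[[j d] b] h IHh] fst e //= /and3P[-> bd /IHh ->].
by rewrite leq_addr andbT -[X in _ == X]addn0 eqn_add2l.
Qed.

Lemma total_decode e h : total (decode e h) = size h * e + code_weight h.
Proof.
elim: h e => [|[[j d] b] h IHh] e /=; first by rewrite /total big_nil.
by rewrite /total big_cons /= -/(total _) IHh; lia.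
Qed.

Lemma total_encode s :
  admissible true 0 s -> code_weight (encode 0 s) = total s.
Proof. by move=> ss; rewrite -{2}(encodeK ss) total_decode muln0. Qed.

(** Guarantees that the bounded ranges of [entries] miss no code of weight [m]. *)
Lemma code_bound fst h :
  code_ok fst h -> all (fun x => maxn x.1.1 x.1.2 <= code_weight h) h.
Proof.
elim: h fst => [|[[j d] b] h IHh] fst //= /and3P[_ _ /IHh hh].
apply/andP; split; first by rewrite geq_max; nia.
by apply: sub_all hh => x /leq_trans; apply; lia.
Qed.

Lemma size_code fst h : code_ok fst h -> size h <= code_weight h.
Proof.
by elim: h fst => [|[[j d] b] h IHh] fst //= /and3P[j0 _ /IHh]; nia.
Qed.

Definition next_ok (a b : cpart) : bool :=
  [&& 0 < b.1.2, a.1.1 + a.1.2 + b.1.2 <= b.1.1 &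
     (b.1.1 == a.1.1 + a.1.2 + b.1.2) ==> ~~ b.2].

Lemma admissible_path a s :
  admissible false (a.1.1 + a.1.2) s = path next_ok a s.
Proof.
elim: s a => [|[[n j] b] s IHs] a //=.
by rewrite -(IHs ((n, j), b)) /= /next_ok /= !andbA.
Qed.

Lemma admissible_sorted s :
  admissible true 0 s = all (fun x => 0 < x.1.2 <= x.1.1) s && sorted next_ok s.
Proof.
case: s => [|[[n j] b] s] //=; rewrite (admissible_path ((n, j), b)) !add0n !andbA.
apply/idP/idP => [/andP[/andP[-> ->] p]|/andP[/andP[-> _] ->] //]; rewrite p andbT /=.
elim: s {n j b} ((n, j), b) p => [|y s IHs] x //= /andP[/and3P[y0 xy _] /IHs ->].
by rewrite y0 andbT; lia.
Qed.

Lemma wdiff_ge0 a b : (0 <= wdiff b a)%R = (a.1.1 + a.1.2 + b.1.2 <= b.1.1).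
Proof. by rewrite /wdiff; lia. Qed.

Lemma wdiff_eq0 a b : (wdiff b a == 0%R) = (b.1.1 == a.1.1 + a.1.2 + b.1.2).
Proof. by rewrite /wdiff; lia. Qed.

(** Condition (ii) is in fact local: a part is a non-first member of some block exactly when its
    difference with its predecessor is 0. *)
Lemma cond_admissible s :
  all (fun x => 0 < x.1.2 <= x.1.1) s ->
  cond_i s && cond_ii s = admissible true 0 s.
Proof.
move=> s_ok; rewrite admissible_sorted s_ok /=.
pose z t := wdiff (nth cp0 s t.+1) (nth cp0 s t) == 0%R.
have cond_iP : reflect (forall t, t.+1 < size s ->
    (0 <= wdiff (nth cp0 s t.+1) (nth cp0 s t))%R) (cond_i s).
  apply: (iffP allP) => [h t ts|h t]; first by apply: h; rewrite mem_iota; lia.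
  by rewrite mem_iota => ts; apply: h; lia.
apply/andP/(sortedP cp0) => [[/cond_iP ci cii] t ts|srt].
  rewrite /next_ok -wdiff_ge0 ci // -wdiff_eq0 -/(z t).
  have := all_nthP cp0 s_ok _ ts => /andP[-> _] /=; apply/implyP => zt.
  (* The zero difference at [t] is extended to its maximal block, from the least [i] with [Pi i] to
     the greatest [j] with [Pj j]. *)
  pose Pi i := (i <= t) && all z (iota i (t.+1 - i)).
  pose Pj j := [&& t < j, j < size s & all z (iota t (j - t))].
  have exi : exists i, Pi i by exists t; rewrite /Pi leqnn subSnn /= zt.
  have exj : exists j, Pj j by exists t.+1; rewrite /Pj ltnSn ts subSnn /= zt.
  have bj j : Pj j -> j <= size s by case/and3P => _ /ltnW.
  case: (ex_minnP exi) => i /andP[it /allP zi] mini.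
  case: (ex_maxnP exj bj) => j /and3P[tj js /allP zj] maxj.
  have i_s : i \in iota 0 (size s) by rewrite mem_iota; lia.
  have j_s : j \in iota 0 (size s) by rewrite mem_iota.
  have /implyP := allP (allP cii i i_s) j j_s.
  have zij u : i <= u < j -> z u.
    case/andP => iu uj; have [ut|tu] := leqP u t.
      by apply: zi; rewrite mem_iota; lia.
    by apply: zj; rewrite mem_iota; lia.
  have blk : max_zero_block s i j.
    rewrite /max_zero_block js (leq_ltn_trans it tj) /=; apply/and3P; split.
    - by apply/allP => u; rewrite mem_iota => u_ij; apply: zij; lia.
    - case: i {mini i_s} it zi (mini i.-1) zij => //= i it zi mini zij.
      apply/negP => zi'; suff : Pi i by move/mini; rewrite ltnn.
      rewrite /Pi (ltnW it); apply/allP => u; rewrite mem_iota => u_it.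
      by case: (eqVneq u i) => [->|ui] //; apply: zij; lia.
    - have [//|jN] /= := eqVneq; apply/negP => zj'.
      suff : Pj j.+1 by move/maxj; rewrite ltnn.
      rewrite /Pj ltnS (ltnW tj) /=; apply/andP; split; first by lia.
      apply/allP => u; rewrite mem_iota => u_tj.
      by case: (eqVneq u j) => [->|uj] //; apply: zij; lia.
  by move=> /(_ blk) /allP; apply; rewrite mem_iota; lia.
split.
  by apply/cond_iP => t ts; rewrite wdiff_ge0; have /and3P[] := srt _ ts.
apply/allP => i _; apply/allP => j _; apply/implyP => /and5P[ij js /allP zij _ _].
apply/allP => -[|k]; rewrite mem_iota => kij; first by lia.
have /and3P[_ _ /implyP] := srt k (ltac:(lia) : k.+1 < size s); apply.
by rewrite -wdiff_eq0; apply: zij; rewrite mem_iota; lia.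
Qed.

End Codes.

(** * Overpartitions with n copies of n as sorted lists *)

Section Parts.
Variable m : nat.
Implicit Type g : ovpc m.

Definition keys : seq (nat * nat) := [seq (n, j) | n <- iota 1 m, j <- iota 1 n].

Definition key (p : 'I_m.+1 * 'I_m.+1) : nat * nat := (nat_of_ord p.1, nat_of_ord p.2).
Definition pos (k : nat * nat) : 'I_m.+1 * 'I_m.+1 := (inord k.1, inord k.2).

Definition block g (k : nat * nat) : seq cpart :=
  let c := g (pos k) in
  if nat_of_ord c.1 is i.+1 then (k, c.2) :: nseq i (k, false) else [::].

Lemma partsE g : parts g = flatten [seq block g k | k <- keys].
Proof. by []. Qed.

Lemma mem_keys k : (k \in keys) = (0 < k.2 <= k.1) && (k.1 <= m).
Proof.
apply/allpairsPdep/idP => [[n [j]]|hk].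
  by rewrite !mem_iota => -[n_m j_n ->] /=; lia.
exists k.1, k.2; rewrite !mem_iota -surjective_pairing; split => //; lia.
Qed.

Lemma keyK : cancel key pos.
Proof. by case=> i j; rewrite /pos /= !inord_val. Qed.

Lemma posK k : k \in keys -> key (pos k) = k.
Proof.
by case: k => n j; rewrite mem_keys /key /= => hk; rewrite !inordK //; lia.
Qed.

Definition lex (k l : nat * nat) : bool := (k.1 < l.1) || (k.1 == l.1) && (k.2 < l.2).

Lemma lex_trans : transitive lex.
Proof. by move=> [a b] [c d] [e f]; rewrite /lex /=; lia. Qed.

Lemma lex_irr : irreflexive lex.
Proof. by move=> [a b]; rewrite /lex /=; lia. Qed.

Lemma keys_sorted : sorted lex keys.
Proof.
rewrite sorted_pairwise; last exact: lex_trans.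
(* The start of the range is generalized for the induction. *)
suff h i n : pairwise lex [seq (n, j) | n <- iota n i, j <- iota 1 n] by exact: h.
elim: i n => // i IHi n /=.
rewrite pairwise_cat IHi andbT; apply/andP; split.
  apply/allrelP => _ _ /mapP[j _ ->] /allpairsPdep[n' [j' [n'i _ ->]]].
  by move: n'i; rewrite mem_iota /lex /=; lia.
rewrite pairwise_map; apply: (@sub_pairwise _ ltn) => [j j' /=|].
  by rewrite /lex /= eqxx => ->; rewrite orbT.
by rewrite -sorted_pairwise ?iota_ltn_sorted //; exact: ltn_trans.
Qed.

Lemma uniq_keys : uniq keys.
Proof. exact: sorted_uniq lex_trans lex_irr _ keys_sorted. Qed.

Lemma block_key g k x : x \in block g k -> x.1 = k.
Proof.
rewrite /block; case: (nat_of_ord _) => // i; rewrite inE => /predU1P[->//|].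
by rewrite mem_nseq => /andP[_ /eqP ->].
Qed.

Lemma parts_keys g x : x \in parts g -> x.1 \in keys.
Proof. by rewrite partsE => /flatten_mapP[k kk /block_key ->]. Qed.

(** Distinct keys have disjoint blocks; this is how [g] is read back from its list. *)
Lemma filter_parts g k : k \in keys -> [seq x <- parts g | x.1 == k] = block g k.
Proof.
rewrite partsE; elim: keys uniq_keys => //= l s IHs /andP[ls us].
rewrite filter_cat inE => /predU1P[->|ks].
  rewrite (_ : filter _ (block g l) = block g l); last first.
    by apply/all_filterP/allP => x /block_key ->.
  rewrite (_ : filter _ (flatten _) = [::]) ?cats0 //.
  apply/eqP; rewrite -[_ == _]negbK -has_filter; apply/negP => /hasP[x].
  by case/flatten_mapP => l' l's /block_key -> /eqP ll'; rewrite -ll' l's in ls.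
rewrite IHs // (_ : filter _ (block g l) = [::]) //.
apply/eqP; rewrite -[_ == _]negbK -has_filter; apply/negP => /hasP[x].
by move=> /block_key -> /eqP lk; rewrite lk ks in ls.
Qed.

Definition supported g :=
  [forall p, (0 < (g p).1)%N ==> ((1 <= p.2) && (p.2 <= p.1))%N].

Lemma parts_inj g g' :
  is_ovp_copies g -> is_ovp_copies g' -> parts g = parts g' -> g = g'.
Proof.
case/and3P => /forallP sg _ /forallP fg /and3P[/forallP sg' _ /forallP fg'] e.
apply/ffunP => p.
have [pk|pk] := boolP (key p \in keys).
  have := filter_parts g pk; rewrite e filter_parts // /block keyK.
  move: (fg p) (fg' p); case: (g p) => -[[|i] ?] b; case: (g' p) => -[[|i'] ?] b' //=.
    rewrite !implybF => /negbTE -> /negbTE -> _.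
    by congr (_, _); apply: val_inj.
  move=> _ _ [-> /(congr1 size)]; rewrite !size_nseq => ii'.
  by congr (_, _); apply: val_inj; rewrite /= ii'.
(* Outside [keys] the support condition forces multiplicity 0, and then the flag condition forces
   [false]. *)
have out g0 : supported g0 ->
    [forall p, (g0 p).2 ==> (0 < (g0 p).1)%N] -> g0 p = (ord0, false).
  move=> /forallP/(_ p) s0 /forallP/(_ p).
  have z : (g0 p).1 = 0 :> nat.
    apply/eqP; rewrite -leqn0 leqNgt; apply: contra pk => /(implyP s0).
    by rewrite mem_keys /= => ->; rewrite -ltnS ltn_ord.
  case: (g0 p) z => a b /= z; rewrite z implybF => /negbTE ->.
  by congr (_, _); apply: val_inj.
by rewrite !out //; apply/forallP.
Qed.

Lemma total_parts g :
  supported g ->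
  total (parts g) = \sum_(p : 'I_m.+1 * 'I_m.+1) p.1 * (g p).1.
Proof.
move=> /forallP sg.
rewrite /total partsE big_flatten /= big_map.
transitivity (\sum_(k <- keys) k.1 * (g (pos k)).1).
  apply: eq_bigr => k _; rewrite (eq_big_seq (fun=> k.1)); last first.
    by move=> x /block_key ->.
  rewrite big_const_seq count_predT iter_addn_0 /block.
  by case: (nat_of_ord _) => //= i; rewrite size_nseq.
rewrite [RHS](bigID (fun p => key p \in keys)) /= [X in _ = _ + X]big1 ?addn0; last first.
  move=> p pk; rewrite (_ : nat_of_ord (g p).1 = 0) ?muln0 //.
  apply/eqP; rewrite -leqn0 leqNgt; apply: contra pk => /(implyP (sg p)).
  by rewrite mem_keys /= => ->; rewrite -ltnS ltn_ord.
rewrite (perm_big [seq key p | p <- [seq p <- index_enum _ | key p \in keys]]) /=.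
  by rewrite big_map big_filter; apply: eq_bigr => p _; rewrite keyK.
apply: uniq_perm uniq_keys _ _.
  by rewrite map_inj_uniq ?filter_uniq ?index_enum_uniq //; exact: can_inj keyK.
move=> k; apply/idP/mapP => [kk|[p]]; last by rewrite mem_filter => /andP[pk _] ->.
by exists (pos k); rewrite ?mem_filter posK // kk mem_index_enum.
Qed.

(** Multiplicity 1 suffices: in an admissible list the values increase strictly, so no n_j
    repeats. *)
Definition build (s : seq cpart) : ovpc m :=
  [ffun p => if key p \in map fst s then (inord 1, (key p, true) \in s)
             else (ord0, false)].

Lemma next_ok_lex a b : 0 < a.1.2 -> next_ok a b -> lex a.1 b.1.
Proof. by rewrite /next_ok /lex => a0 /and3P[b0 ab _]; lia. Qed.

Lemma admissible_lex s : admissible true 0 s -> sorted lex (map fst s).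
Proof.
rewrite admissible_sorted => /andP[]; case: s => // x s.
elim: s x => //= y s IHs x /andP[/andP[x0 _] ys] /andP[xy ss].
by rewrite (next_ok_lex x0 xy) IHs.
Qed.

Lemma admissible_keys s :
  admissible true 0 s -> total s = m -> {subset map fst s <= keys}.
Proof.
rewrite admissible_sorted => /andP[/allP s_ok _] sm _ /mapP[x xs ->].
rewrite mem_keys (s_ok x xs) /= -sm /total (big_rem x) //=; exact: leq_addr.
Qed.

Lemma buildK s : 0 < m -> admissible true 0 s -> total s = m -> parts (build s) = s.
Proof.
move=> m0 ss sm; have slex := admissible_lex ss.
have uk : uniq (map fst s) := sorted_uniq lex_trans lex_irr slex.
rewrite partsE.
transitivity [seq (k, (k, true) \in s) | k <- [seq k <- keys | k \in map fst s]].
  have : all (mem keys) keys by apply/allP.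
  elim: {2 3 4}keys => //= k l IHl /andP[kk /IHl ->].
  rewrite {1}/block ffunE posK //; case: (k \in _) => //=.
  by rewrite inordK.
have -> : [seq k <- keys | k \in map fst s] = map fst s.
  apply: (irr_sorted_eq lex_trans lex_irr) => //.
    exact: sorted_filter lex_trans _ _ keys_sorted.
  move=> k; rewrite mem_filter andb_idr // => ks; exact: admissible_keys ks.
rewrite -map_comp -[RHS]map_id; apply/eq_in_map => -[k b] xs /=.
congr (_, _); case: b xs => [-> //|xs]; apply/negP => xs'.
(* Were [(k, true)] in [s] too, uniqueness of keys would give both entries the same index, although
   their flags differ. *)
have i1 := index_mem (k, false) s; have i2 := index_mem (k, true) s.
have := nth_uniq (0, 0) (i := index (k, false) s) (j := index (k, true) s) _ _ uk.
rewrite !size_map i1 i2 => /(_ xs xs').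
rewrite !(nth_map cp0) ?i1 ?i2 // !nth_index //= eqxx => /esym/eqP e.
have := nth_index cp0 xs; rewrite e nth_index //.
Qed.

Lemma build_supported s : 0 < m -> admissible true 0 s -> total s = m ->
  is_ovp_copies (build s).
Proof.
move=> m0 ss sm.
have sup : supported (build s).
  apply/forallP => p; apply/implyP; rewrite ffunE; case: ifP => // pk _.
  by have := admissible_keys ss sm pk; rewrite mem_keys => /andP[].
rewrite /is_ovp_copies -/(supported _) sup -total_parts // buildK // sm eqxx.
apply/forallP => p; apply/implyP; rewrite ffunE; case: ifP => // pk _ /=.
by rewrite inordK.
Qed.

Lemma admissible_parts g :
  cond_i (parts g) && cond_ii (parts g) = admissible true 0 (parts g).
Proof.
apply: cond_admissible; apply/allP => x /parts_keys.
by rewrite mem_keys => /andP[].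
Qed.

End Parts.

(** * Counting by finite lists of codes *)

Section Enumeration.
Variable m : nat.

Definition flags (fst : bool) (d : nat) : seq bool :=
  if ~~ fst && (d == 0) then [:: false] else [:: true; false].

Definition entries (fst : bool) : seq cpart :=
  [seq (jd, b) | jd <- [seq (j, d) | j <- iota 1 m, d <- iota 0 m.+1],
                 b <- flags fst jd.2].

Fixpoint codes (fst : bool) (N : nat) : seq (seq cpart) :=
  if N is N'.+1 then [seq x :: h | x <- entries fst, h <- codes false N']
  else [:: [::]].

Lemma mem_flags fst d b : (b \in flags fst d) = (~~ fst && (d == 0) ==> ~~ b).
Proof. by rewrite /flags; case: ifP; case: b. Qed.

Lemma mem_entries fst x : (x \in entries fst) =
  [&& 0 < x.1.1, maxn x.1.1 x.1.2 <= m & ~~ fst && (x.1.2 == 0) ==> ~~ x.2].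
Proof.
have jdE (k : nat * nat) : (k \in [seq (j, d) | j <- iota 1 m, d <- iota 0 m.+1]) =
    (0 < k.1) && (maxn k.1 k.2 <= m).
  apply/allpairsPdep/idP => [[j [d [jm dm ->]]]|]; rewrite geq_max.
    by move: jm dm; rewrite !mem_iota /=; lia.
  by move=> hk; exists k.1, k.2; rewrite !mem_iota -surjective_pairing; split=> //; lia.
apply/allpairsPdep/idP => [[jd [b [+ + ->]]]|hx].
  by rewrite jdE mem_flags /= andbA => -> ->.
exists x.1, x.2; rewrite jdE mem_flags -surjective_pairing.
by case/and3P: hx => -> -> ->.
Qed.

Lemma mem_codes fst N h : (h \in codes fst N) =
  [&& size h == N, code_ok fst h & all (fun x => maxn x.1.1 x.1.2 <= m) h].
Proof.
elim: N fst h => [|N IHN] fst [|[[j d] b] h] //=.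
  by apply/allpairsP => -[[? ?] []].
rewrite eqSS; apply/allpairsP/idP => [[[x h'] /= []]|].
  rewrite mem_entries IHN => /and3P[x1 x2 x3] /and3P[h1 h2 h3] [xE ->].
  by move: x1 x2 x3; rewrite -xE /= => -> -> ->; rewrite h1 h2 h3.
case/and3P => hN /and3P[j0 db hok] /andP[jdm hm].
by exists ((j, d, b), h); split => //=; rewrite ?mem_entries ?IHN /= ?j0 ?jdm ?hN ?hok.
Qed.

Lemma uniq_entries fst : uniq (entries fst).
Proof.
apply: allpairs_uniq_dep => [|jd _|[x b] [y c] _ _ /= [-> ->] //].
  by apply: allpairs_uniq; rewrite ?iota_uniq // => -[? ?] [? ?].
by rewrite /flags; case: ifP.
Qed.

Lemma uniq_codes fst N : uniq (codes fst N).
Proof.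
elim: N fst => // N IHN fst; apply: allpairs_uniq => //; first exact: uniq_entries.
by move=> [? ?] [? ?] _ _ /= [-> ->].
Qed.

(** [encode 0] after [parts] is a bijection onto the codes of weight [m], here sorted by length,
    which is at most the weight. *)
Lemma L_codes : 0 < m ->
  L m = \sum_(N < m.+1) count (fun h => code_weight h == m) (codes true N).
Proof.
move=> m0; rewrite /L.
set G := [set g | _].
have GP g : reflect [/\ is_ovp_copies g, admissible true 0 (parts g) &
    total (parts g) = m] (g \in G).
  rewrite inE admissible_parts; apply: (iffP andP) => [[og ag]|[og ag _]] //.
  split=> //; case/and3P: og => sg /eqP + _; rewrite total_parts //.
have sizeG g : g \in G -> size (parts g) < m.+1.
  case/GP => _ ag tg; rewrite ltnS -[leqRHS]tg -(total_encode ag) -(size_encode 0).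
  exact: size_code (code_ok_encode ag).
rewrite -sum1_card (partition_big (fun g => inord (size (parts g)) : 'I_m.+1) xpredT) //=.
apply: eq_bigr => N _; rewrite -size_filter.
rewrite -big_filter sum1_size -(size_map (fun g => encode 0 (parts g))).
apply/perm_size/uniq_perm; last 1 first.
- move=> h; rewrite mem_filter mem_codes; apply/mapP/idP => [[g]|].
    rewrite mem_filter mem_index_enum andbT => /andP[gG /eqP gN] ->; have /GP[og ag tg] := gG.
    rewrite total_encode // tg eqxx size_encode -gN inordK ?sizeG // eqxx /=.
    have := code_ok_encode ag => cg; rewrite cg /=.
    by have := code_bound cg; rewrite total_encode // tg.
  case/andP => /eqP hm /and3P[/eqP hN hok _].
  have ah := admissible_decode 0 hok.
  have th : total (decode 0 h) = m by rewrite total_decode muln0.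
  exists (build m (decode 0 h)); last by rewrite buildK // decodeK.
  rewrite mem_filter mem_index_enum andbT buildK //; apply/andP; split.
    by apply/GP; rewrite buildK //; split => //; exact: build_supported.
  by rewrite -(size_encode 0) decodeK hN inord_val.
- rewrite map_inj_in_uniq ?filter_uniq ?index_enum_uniq // => g g'.
  rewrite !mem_filter => /andP[/andP[/GP[og ag _] _] _] /andP[/andP[/GP[og' ag' _] _] _] e.
  by apply: parts_inj => //; rewrite -(encodeK ag) e (encodeK ag').
- exact/filter_uniq/uniq_codes.
Qed.

End Enumeration.

Local Open Scope ring_scope.

(** * Basic hypergeometric identities with a nilpotent base *)

Section BilateralSum.
Variable A : zmodType.

(* The sum of f over the window -W <= r < W, which r |-> -1 - r preserves. *)
Definition bsum (W : nat) (f : int -> A) : A :=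
  \sum_(r < W) (f (Posz r) + f (Negz r)).

Lemma eq_bsum W (f g : int -> A) : f =1 g -> bsum W f = bsum W g.
Proof. by move=> fg; apply: eq_bigr => r _; rewrite !fg. Qed.

Lemma bsumD W (f g : int -> A) :
  bsum W (fun r => f r + g r) = bsum W f + bsum W g.
Proof. by rewrite /bsum -big_split; apply: eq_bigr => r _; rewrite addrACA. Qed.

(** The reflection exchanges [Posz r] and [Negz r], so each pair grouped in [bsum] cancels. *)
Lemma bsum_antisym W (f : int -> A) :
  (forall r, f (-1 - r) = - f r) -> bsum W f = 0.
Proof.
move=> fN; apply: big1 => r _.
by have := fN (Posz r); rewrite (_ : -1 - Posz r = Negz r) ?[f (Negz r)]/= => [->|];
  [rewrite subrr | lia].
Qed.

Lemma bsum1 W (f : int -> A) :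
  (forall r, r != 0 -> f r = 0) -> bsum W.+1 f = f 0.
Proof.
move=> f0; rewrite /bsum big_ord_recl big1 => [|i _];
by rewrite /= ?(f0 (Negz _)) ?(f0 (Posz _.+1)) ?addr0.
Qed.

(** The window reaches -(W+1) but not W+1; once that extra term vanishes, the sum is symmetric about
    0. *)
Lemma bsum_center W (f : int -> A) :
  f (- W.+1%:Z) = 0 ->
  bsum W.+1 f = f 0 + \sum_(r < W) (f r.+1%:Z + f (- r.+1%:Z)).
Proof.
move=> fW; rewrite /bsum big_split /= big_ord_recl big_ord_recr /=.
rewrite (_ : Negz W = - W.+1%:Z) ?fW ?addr0; last by lia.
by rewrite -addrA -big_split.
Qed.

Lemma bsum_opp W (f : int -> A) :
  f W%:Z = 0 -> f (- W%:Z) = 0 -> bsum W (fun r => f (- r)) = bsum W f.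
Proof.
case: W => [|W] fW fNW; first by rewrite /bsum !big_ord0.
rewrite !bsum_center ?opprK // oppr0; congr (_ + _).
by apply: eq_bigr => r _; rewrite addrC opprK.
Qed.

End BilateralSum.

Lemma bsum_distrr (A : pzRingType) W (c : A) (f : int -> A) :
  bsum W (fun r => c * f r) = c * bsum W f.
Proof. by rewrite /bsum mulr_sumr; apply: eq_bigr => r _; rewrite mulrDr. Qed.

(** * The q-shifted factorials (a; p)_n *)

Section Pochhammer.
Variables (A : comNzRingType).
Implicit Types a p : A.

Definition qpoch a p n : A := \prod_(i < n) (1 - a * p ^+ i).

Lemma qpoch0 a p : qpoch a p 0 = 1.
Proof. exact: big_ord0. Qed.

Lemma qpochSr a p n : qpoch a p n.+1 = qpoch a p n * (1 - a * p ^+ n).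
Proof. exact: big_ord_recr. Qed.

Lemma qpochSl a p n : qpoch a p n.+1 = (1 - a) * qpoch (a * p) p n.
Proof.
rewrite /qpoch big_ord_recl expr0 mulr1; congr (_ * _).
by apply: eq_bigr => i _; rewrite exprS mulrA.
Qed.

Lemma qpochD a p m n :
  qpoch a p (m + n) = qpoch a p m * qpoch (a * p ^+ m) p n.
Proof.
rewrite /qpoch big_split_ord; congr (_ * _).
by apply: eq_bigr => i _; rewrite exprD mulrA.
Qed.

Lemma qpoch_sqr p n : qpoch (p ^+ 2) (p ^+ 2) n = qpoch p p n * qpoch (- p) p n.
Proof.
rewrite /qpoch -big_split; apply: eq_bigr => i _ /=.
by rewrite -exprM mul2n -addnn exprD; ring.
Qed.

(** Odd exponents form (p; p^2)_n and even ones (p^2; p^2)_n, which factors by [qpoch_sqr]. *)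
Lemma qpoch_double p n :
  qpoch p p n.*2 = qpoch p (p ^+ 2) n * (qpoch p p n * qpoch (- p) p n).
Proof.
rewrite -qpoch_sqr; elim: n => [|n IHn]; first by rewrite !qpoch0 mulr1.
rewrite doubleS !qpochSr {}IHn -exprM mul2n -exprS -exprD !exprS.
ring.
Qed.

Lemma qpochN1 p n : qpoch (-1) p n.+1 = 2 * qpoch (- p) p n.
Proof. by rewrite qpochSl opprK mulN1r. Qed.

End Pochhammer.

(** * Series identities in a ring where q^K = 0 *)

Section NilpotentBase.
Variables (A : comUnitRingType) (q : A) (K : nat).
Hypothesis qK : q ^+ K = 0.

Lemma qX0 n : (K <= n)%N -> q ^+ n = 0.
Proof. by move=> Kn; rewrite -(subnKC Kn) exprD qK mul0r. Qed.

Lemma nil_unit (x : A) n : x ^+ n = 0 -> 1 - x \is a GRing.unit.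
Proof.
move=> xn; apply/unitrP; exists (\sum_(i < n) x ^+ i).
have h : (1 - x) * (\sum_(i < n) x ^+ i) = 1.
  by have := subrX1 x n; rewrite xn sub0r -[x - 1]opprB mulNr => /oppr_inj.
by rewrite mulrC h.
Qed.

Lemma qpoch_unit c k n : qpoch (c * q ^+ k.+1) q n \is a GRing.unit.
Proof.
apply: rpred_prod => i _; apply: (@nil_unit _ K).
by rewrite -mulrA -exprD addSn exprS mulrCA exprMn qK mul0r.
Qed.

Lemma qpochq_unit n : qpoch q q n \is a GRing.unit.
Proof. by have := qpoch_unit 1 0 n; rewrite mul1r. Qed.

Lemma qpochNq_unit n : qpoch (- q) q n \is a GRing.unit.
Proof. by have := qpoch_unit (-1) 0 n; rewrite mulN1r. Qed.

(** All factors from index [K] on are 1, so such a product plays the role of (cq; q)_oo. *)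
Lemma qpoch_stable c m n :
  (K <= m)%N -> (K <= n)%N -> qpoch (c * q) q m = qpoch (c * q) q n.
Proof.
suff h k : (K <= k)%N -> qpoch (c * q) q k = qpoch (c * q) q K.
  by move=> Km Kn; rewrite !h.
move=> Kk; rewrite -(subnKC Kk) qpochD -mulrA -exprS qX0 // mulr0.
by rewrite /qpoch [X in _ * X]big1 ?mulr1 // => i _; rewrite mul0r subr0.
Qed.

(** The absolute value only makes the power total: where an exponent is negative, the term carries a
    vanishing [w]. *)
Definition qz (a : int) : A := q ^+ `|a|%N.

Lemma qzD (a b : int) : 0 <= a -> 0 <= b -> qz (a + b) = qz a * qz b.
Proof. by move=> a0 b0; rewrite /qz -exprD; congr (_ ^+ _); lia. Qed.

(* [w a] is 1 / (q; q)_a, with the usual convention that it vanishes at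
   negative integers *)
Definition w (a : int) : A := if a is Posz n then (qpoch q q n)^-1 else 0.
Arguments w : simpl never.

(** At [a = 0] the factor 1 - q^0 vanishes, in agreement with [w (-1) = 0], so the recurrence holds
    at every integer. *)
Lemma w_pred (a b : int) : b = a - 1 -> w b = (1 - qz a) * w a.
Proof.
move=> ->; case: a => [[|n]|n].
- by rewrite /qz expr0 subrr mul0r.
- rewrite (_ : Posz n.+1 - 1 = n) /w; last by lia.
  rewrite /qz /= qpochSr -exprS.
  have := qpochq_unit n.+1; rewrite qpochSr -exprS unitrM => /andP[u1 u2].
  by rewrite invrM // mulVKr.
- by rewrite (_ : Negz n - 1 = Negz n.+1) /w ?mulr0 //; lia.
Qed.

Lemma w_neg a : a < 0 -> w a = 0.
Proof. by case: a. Qed.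

Lemma w_large a : (K%:Z <= a) -> w a = (qpoch q q K)^-1.
Proof.
case: a => // n Kn; congr (_^-1); have := @qpoch_stable 1 n K.
by rewrite mul1r; apply; lia.
Qed.

(** A form of q-Chu-Vandermonde, by induction on [M] with [b] free. The splitting 1 - q^(M+1) = (1 -
    q^(M+1-i)) + q^(M+1-i) (1 - q^i) yields a sum at [b] and a shifted one at [b * q]. *)
Lemma qbinom_sum b t M :
  \sum_(i < M.+1) w (M%:Z - i%:Z) * w i * (qpoch b q i * (- t) ^+ i *
      q ^+ 'C(i, 2) * qpoch (b * t * q ^+ i) q (M - i)) = qpoch t q M * w M.
Proof.
elim: M b => [|M IHM] b.
  by rewrite big_ord_recl big_ord0 /w /= !qpoch0 !expr0 invr1; ring.
have u : 1 - q ^+ M.+1 \is a GRing.unit.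
  by apply: (@nil_unit _ K); rewrite exprAC qK expr0n.
apply: (mulrI u).
have wM : (1 - q ^+ M.+1) * w M.+1 = w M.
  by rewrite (w_pred (a := M.+1) (b := M)) //; lia.
rewrite mulrCA wM.
(* [f 1] has the first [w] lowered, [f 0] the second. *)
pose f (x : int) (i : nat) : A := w (M.+1%:Z - i%:Z - x) * w (i%:Z - 1 + x).
pose g i := qpoch b q i * (- t) ^+ i *
      q ^+ 'C(i, 2) * qpoch (b * t * q ^+ i) q (M.+1 - i).
transitivity (\sum_(i < M.+2) (f 1 i * g i) +
              \sum_(i < M.+2) q ^+ (M.+1 - i) * f 0 i * g i).
  rewrite -big_split mulr_sumr; apply: eq_bigr => i _ /=; rewrite /f.
  have := ltn_ord i; move: {i}(nat_of_ord i) => i; rewrite ltnS => iM.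
  rewrite -/(g i) subrK (w_pred (a := M.+1%:Z - i%:Z) (b := _ - 1)) //.
  rewrite (w_pred (a := i%:Z) (b := i%:Z - 1 + 0)); last by rewrite addr0.
  rewrite subr0 /qz /= (_ : `|M.+1%:Z - i%:Z|%N = (M.+1 - i)%N); last by lia.
  rewrite -[X in 1 - q ^+ X](subnK iM) exprD; set c := _ ^+ (_ - _).
  rewrite -!mulrA.
  ring.
have f1 : f 1 M.+1 = 0 by rewrite /f w_neg ?mul0r //; lia.
have f0 : f 0 0%N = 0 by rewrite /f [X in _ * X]w_neg ?mulr0 //; lia.
rewrite big_ord_recr [X in _ + X]big_ord_recl /= f1 f0 mulr0 !mul0r addr0 add0r.
(* This is 1 - t q^M = (1 - b t q^M) - t q^M (1 - b), matched with the induction hypotheses at [b]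
   and [b * q]. *)
transitivity ((1 - b * t * q ^+ M) * (qpoch t q M * w M) -
   (t * q ^+ M * (1 - b)) * (qpoch t q M * w M)); last by rewrite qpochSr /=; ring.
rewrite -{1}(IHM b) -(IHM (b * q)) !mulr_sumr -sumrN; congr (_ + _).
  apply: eq_bigr => i _; rewrite /f /g subrK.
  rewrite (_ : M.+1%:Z - i%:Z - 1 = M%:Z - i%:Z); last by lia.
  have iM : (i <= M)%N by rewrite -ltnS.
  rewrite subSn // qpochSr -[b * t * q ^+ i * _]mulrA -exprD subnKC //; ring.
apply: eq_bigr => i _; rewrite /f /g /= /bump /= add1n.
rewrite (_ : M.+1%:Z - i.+1%:Z - 0 = M%:Z - i%:Z); last by lia.
rewrite (_ : i.+1%:Z - 1 + 0 = i); last by lia.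
have iM : (i <= M)%N by rewrite -ltnS.
rewrite subSS qpochSl binS bin1 addnC !exprD exprS.
rewrite -[X in _ * q ^+ X * (1 - b)](subnK iM) exprD.
rewrite (_ : b * t * q ^+ i.+1 = b * q * t * q ^+ i); first by ring.
by rewrite exprS; ring.
Qed.

Definition sg (r : int) : A := (-1) ^+ `|r|%N.

Lemma sg_opp r : sg (- r) = sg r.
Proof. by rewrite /sg abszN. Qed.

Lemma sg_refl r : sg (-1 - r) = - sg r.
Proof.
case: r => n; rewrite /sg.
  by rewrite (_ : `|(-1 - Posz n)%R|%N = n.+1) ?exprS ?mulN1r //; lia.
by rewrite (_ : `|(-1 - Negz n)%R|%N = n) /= ?exprS ?mulN1r ?opprK //; lia.
Qed.

(** Since 1 - q^(a+b) = (1 - q^b) + q^b (1 - q^a), each summand lowers one [w]. *)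
Lemma w_mul (a b : int) k : a + b = k%:Z ->
  (1 - q ^+ k) * (w a * w b) = w a * w (b - 1) + qz b * (w (a - 1) * w b).
Proof.
move=> abk; rewrite !(w_pred (erefl (_ - 1))).
have [a0|a0] := ltP a 0; first by rewrite (w_neg a0); ring.
have [b0|b0] := ltP b 0; first by rewrite (w_neg b0); ring.
rewrite (_ : q ^+ k = qz a * qz b); first by ring.
by rewrite -qzD // abk.
Qed.

(** The step from n to n + 1 passes through the intermediate sum [P], by [PU] and then [VP]; each
    half raises one of the two [w] arguments. *)
Lemma bailey_pair_even W n : (n < W)%N ->
  bsum W (fun r => sg r * qz (r * r - r) * (w (n%:Z - 2 * r) * w (n%:Z + 2 * r)))
    * qpoch q q n.*2 = q ^+ 'C(n, 2) * qpoch (- q) q n.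
Proof.
elim: n => [|n IHn].
  case: W => // W _; rewrite bsum1 => [|r r0].
    by rewrite !mulr0 addr0 ?subr0 /qz /sg /w /= !qpoch0 invr1 !mul1r.
  have [rp|rp] := ltP 0 r; first by rewrite [X in _ * (X * _)]w_neg ?mul0r ?mulr0 //; lia.
  rewrite [X in _ * (_ * X)]w_neg ?mulr0 //; lia.
move=> nW; have {}IHn := IHn (ltnW nW).
set U := bsum W _ in IHn; set V := bsum W _.
pose P := bsum W (fun r => sg r * qz (r * r + r) *
             (w (n%:Z - 2 * r) * w (n.+1%:Z + 2 * r))).
(* [w_mul] gives [P] twice: reflected by r |-> -r, and multiplied by q^(n+1). *)
have VP : (1 - q ^+ n.*2.+2) * V = (1 + q ^+ n.+1) * P.
  rewrite [RHS]mulrDl mul1r -{1}[P](bsum_opp (W := W)); first last.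
  - by rewrite [X in _ * (_ * X)]w_neg ?mulr0 //; lia.
  - by rewrite [X in _ * (X * _)]w_neg ?mul0r ?mulr0 //; lia.
  rewrite -!bsum_distrr -bsumD; apply: eq_bsum => r.
  rewrite mulrCA w_mul; last by lia.
  rewrite sg_opp mulrDr; congr (_ + _).
    congr (_ * qz _ * _); first by ring.
    by rewrite mulrC; congr (w _ * w _); lia.
  rewrite (_ : n.+1%:Z - 2 * r - 1 = n%:Z - 2 * r); last by lia.
  have [b0|b0] := ltP (n.+1%:Z + 2 * r) 0; first by rewrite (w_neg b0) !mulr0.
  have e : qz (r * r - r) * qz (n.+1%:Z + 2 * r) = q ^+ n.+1 * qz (r * r + r).
    rewrite -qzD //; last by nia.
    by rewrite -/(qz n.+1%:Z) -qzD //; [congr qz; lia | nia].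
  by rewrite -!mulrA [qz _ * (qz _ * _)]mulrA e; ring.
(* The terms in which [w_mul] lowers n - 2r are antisymmetric under r |-> -1 - r and cancel. *)
have PU : (1 - q ^+ n.*2.+1) * P = q ^+ n * U.
  transitivity (bsum W (fun r => q ^+ n * (sg r * qz (r * r - r) *
      (w (n%:Z - 2 * r) * w (n%:Z + 2 * r))) +
      sg r * qz (r * r + r) * (w (n%:Z - 2 * r - 1) * w (n.+1%:Z + 2 * r)))).
    rewrite -bsum_distrr; apply: eq_bsum => r.
    rewrite mulrCA [w _ * _]mulrC w_mul; last by lia.
    rewrite mulrDr addrC; congr (_ + _); last by rewrite [w _ * _]mulrC.
    rewrite (_ : n.+1%:Z + 2 * r - 1 = n%:Z + 2 * r); last by lia.
    have [b0|b0] := ltP (n%:Z - 2 * r) 0; first by rewrite (w_neg b0); ring.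
    have e : qz (r * r + r) * qz (n%:Z - 2 * r) = q ^+ n * qz (r * r - r).
      rewrite -qzD //; last by nia.
      by rewrite -/(qz n%:Z) -qzD //; [congr qz; lia | nia].
    by rewrite -!mulrA [qz _ * (qz _ * _)]mulrA e; ring.
  rewrite bsumD bsum_distrr [X in _ + X]bsum_antisym ?addr0 // => r.
  rewrite sg_refl !mulNr; congr (- (_ * qz _ * _)); first by ring.
  by rewrite mulrC; congr (w _ * w _); lia.
rewrite doubleS !qpochSr -!exprS.
transitivity ((1 - q ^+ n.*2.+2) * V * (1 - q ^+ n.*2.+1) * qpoch q q n.*2); first by ring.
rewrite VP (_ : _ * _ * _ * _ =
  (1 + q ^+ n.+1) * ((1 - q ^+ n.*2.+1) * P) * qpoch q q n.*2); last by ring.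
rewrite PU (_ : _ * _ * _ = (1 + q ^+ n.+1) * q ^+ n * (U * qpoch q q n.*2)); last by ring.
by rewrite IHn binS bin1 exprD mulNr -exprS; ring.
Qed.

(** The same two half steps; here both error terms are multiples of the sum in [odd0], which is
    antisymmetric. *)
Lemma gauss_finite W n : (n < W)%N ->
  bsum W (fun r => sg r * qz (r * r) * (w (n%:Z - r) * w (n%:Z + r)))
    * qpoch (q ^+ 2) (q ^+ 2) n = 1.
Proof.
elim: n => [|n IHn].
  case: W => // W _; rewrite bsum1 => [|r r0].
    by rewrite !mulr0 addr0 ?subr0 /qz /sg /w /= !qpoch0 invr1 !mul1r.
  have [rp|rp] := ltP 0 r; first by rewrite [X in _ * (X * _)]w_neg ?mul0r ?mulr0 //; lia.
  by rewrite [X in _ * (_ * X)]w_neg ?mulr0 //; lia.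
move=> nW; have {IHn} := IHn (ltnW nW).
set U := bsum W _; set V := bsum W _.
pose P := bsum W (fun r => sg r * qz (r * r) *
             (w (n%:Z - r) * w (n.+1%:Z + r))).
have odd0 : bsum W (fun r => sg r * qz (r * r + r) *
             (w (n%:Z - r) * w (n.+1%:Z + r))) = 0.
  apply: bsum_antisym => r; rewrite sg_refl !mulNr; congr (- (_ * qz _ * _)).
    by ring.
  by rewrite mulrC; congr (w _ * w _); lia.
have qzr r : qz (r * r) * (qz (n.+1%:Z + r) * (w (n%:Z - r) * w (n.+1%:Z + r)))
    = q ^+ n.+1 * (qz (r * r + r) * (w (n%:Z - r) * w (n.+1%:Z + r))).
  have [b0|b0] := ltP (n.+1%:Z + r) 0; first by rewrite (w_neg b0); ring.
  rewrite mulrA [RHS]mulrA; congr (_ * _).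
  rewrite -qzD //; last by nia.
  by rewrite -/(qz n.+1%:Z) -qzD //; [congr qz; lia | nia].
have VP : (1 - q ^+ n.*2.+2) * V = P.
  transitivity (P + q ^+ n.+1 * 0); last by rewrite mulr0 addr0.
  rewrite -odd0 -!bsum_distrr.
  rewrite -{1}[P](bsum_opp (W := W)); first last.
  - by rewrite [X in _ * (_ * X)]w_neg ?mulr0 //; lia.
  - by rewrite [X in _ * (X * _)]w_neg ?mul0r ?mulr0 //; lia.
  rewrite -bsumD; apply: eq_bsum => r.
  rewrite mulrCA w_mul; last by lia.
  rewrite sg_opp mulrDr; congr (_ + _).
    rewrite mulrNN; congr (_ * _).
    by rewrite mulrC; congr (w _ * w _); lia.
  rewrite (_ : n.+1%:Z - r - 1 = n%:Z - r); last by lia.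
  by rewrite -!mulrA qzr mulrCA.
have PU : U = P.
  apply/eqP; rewrite -subr_eq0 -[X in _ - X]mul1r -mulNr -bsum_distrr -bsumD.
  apply/eqP; transitivity (- q ^+ n.+1 * 0); last by rewrite mulr0.
  rewrite -odd0 -bsum_distrr; apply: eq_bsum => r.
  rewrite (w_pred (a := n.+1%:Z + r) (b := n%:Z + r)); last by lia.
  transitivity (- sg r * (q ^+ n.+1 * (qz (r * r + r) *
                 (w (n%:Z - r) * w (n.+1%:Z + r))))); last by ring.
  by rewrite -qzr; ring.
rewrite PU -VP qpochSr -exprM -exprD (_ : 2 + 2 * n = n.*2.+2)%N; last by lia.
by move=> e; apply: etrans e; ring.
Qed.

(** Take n = 2K in [gauss_finite]: for |r| < K both [w] equal 1 / (q; q)_oo, and for |r| >= K the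
    power q^(r^2) is 0. *)
Lemma gauss_theta :
  bsum K.*2.+1 (fun r => sg r * qz (r * r)) * qpoch (- q) q K = qpoch q q K.
Proof.
have e := @gauss_finite K.*2.+1 K.*2 (leqnn _).
have uE := qpochq_unit K; set E := qpoch q q K in uE *.
have eE : qpoch q q K.*2 = E.
  by rewrite -[q in qpoch q]mul1r (@qpoch_stable 1 _ K) ?mul1r //; lia.
have eN : qpoch (- q) q K.*2 = qpoch (- q) q K.
  by rewrite -mulN1r (@qpoch_stable (-1) _ K) //; lia.
move: e; rewrite qpoch_sqr eE eN; set T := bsum _ (fun r => sg r * qz (r * r)).
have -> : bsum K.*2.+1 (fun r => sg r * qz (r * r) *
            (w (K.*2%:Z - r) * w (K.*2%:Z + r))) = E^-1 * E^-1 * T.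
  rewrite -bsum_distrr; apply: eq_bsum => r; rewrite [RHS]mulrC.
  have [rK|Kr] := ltnP `|r|%N K; first by rewrite !w_large //; lia.
  by rewrite [qz _]qX0 ?mulr0 ?mul0r //; nia.
move=> e; rewrite -[RHS]mulr1 -e.
transitivity (T * qpoch (- q) q K * (E * E^-1) * (E * E^-1)); last by ring.
by rewrite divrr // !mulr1.
Qed.

(** The gamma_s of the conjugate Bailey pair with delta_N = (-1; q)_N q^(N(N+1)/2); terms with N >=
    K would vanish. *)
Definition bailey_sum (s : int) : A := \sum_(N < K)
  qpoch (-1) q N * q ^+ 'C(N.+1, 2) * (w (N%:Z - s) * w (N%:Z + s)).

Lemma bailey_sumN s : bailey_sum (- s) = bailey_sum s.
Proof.
by apply: eq_bigr => N _; rewrite opprK; congr (_ * _); exact: mulrC.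
Qed.

Lemma bin2D m n : 'C(m + n, 2) = ('C(m, 2) + m * n + 'C(n, 2))%N.
Proof.
elim: n => [|n IHn]; first by rewrite muln0 !addn0.
by rewrite addnS !binS !bin1 IHn mulnS; lia.
Qed.

(** After the shift N = s + i, this is the limit of [qbinom_sum] as M grows, reached already at M =
    2K. *)
Lemma bailey_sumE (s : nat) :
  bailey_sum s%:Z * qpoch q q K * qpoch (- q) q s =
  qpoch (-1) q s * q ^+ 'C(s.+1, 2) * qpoch (- q) q K.
Proof.
have uE := qpochq_unit K; set E := qpoch q q K in uE *.
have -> : bailey_sum s = \sum_(i < K) qpoch (-1) q s * q ^+ 'C(s.+1, 2) *
   (w i * (qpoch (- q ^+ s) q i * q ^+ (s.+1 * i) * q ^+ 'C(i, 2) * w (i%:Z + s.*2%:Z))).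
  pose f N := qpoch (-1) q N * q ^+ 'C(N.+1, 2) * (w (N%:Z - s%:Z) * w (N%:Z + s%:Z)).
  transitivity (\sum_(N < s + K) f N).
    rewrite addnC big_split_ord /= [X in _ + X]big1 ?addr0 // => i _.
    rewrite /f [q ^+ _]qX0 ?mulr0 ?mul0r //.
    by rewrite binS bin1; lia.
  rewrite big_split_ord /= [X in X + _]big1 ?add0r => [|i _]; last first.
    by rewrite /f w_neg ?mul0r ?mulr0 //; have := ltn_ord i; lia.
  apply: eq_bigr => i _; rewrite /f qpochD -addSn bin2D !exprD mulN1r.
  rewrite (_ : (s + i)%N%:Z - s%:Z = i); last by lia.
  rewrite (_ : (s + i)%N%:Z + s%:Z = i%:Z + s.*2%:Z); last by lia.
  ring.
rewrite -mulr_sumr -!mulrA; congr (_ * (_ * _)).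
transitivity (qpoch (- q ^+ s.+1) q K.*2 * qpoch (- q) q s); last first.
  have := qpochD (- q) q s K.*2; rewrite mulNr -exprS [RHS]mulrC => <-.
  by rewrite -mulN1r; apply: qpoch_stable; lia.
rewrite mulrA; congr (_ * _).
(* With these [b] and [t], -t = q^(s+1) and b t q^i = q^(2s+1+i); moreover 2K - i >= K for i < K, so
   those [w] have their limit value. *)
have := qbinom_sum (- q ^+ s) (- q ^+ s.+1) K.*2.
rewrite (w_large (a := K.*2)); last by lia.
move=> /(congr1 (fun x => x * E)); rewrite divrK // => <-.
rewrite !mulr_suml -[K.*2]addnn -addnS big_split_ord /=
  [X in _ + X]big1 ?addr0 => [|i _]; last first.
  by rewrite opprK -exprM [q ^+ (s.+1 * _)]qX0 ?(mulr0, mul0r) //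
    (leq_trans (leq_addr i K)) ?leq_pmull.
apply: eq_bigr => i _; have := ltn_ord i => iK.
rewrite (w_large (a := (K + K)%N%:Z - i%:Z)); last by lia.
rewrite (_ : - q ^+ s * - q ^+ s.+1 * q ^+ i = q ^+ (s + s.+1 + i));
  last by rewrite mulrNN -!exprD.
rewrite opprK -exprM.
(* Cutting (q; q)_oo after 2s + i factors produces the missing 1 / (q; q)_(2s+i). *)
have eE : E = qpoch q q (s.*2 + i) * qpoch (q ^+ (s + s.+1 + i)) q (K + K - i).
  rewrite (_ : s + s.+1 + i = (s.*2 + i).+1)%N ?exprS -?qpochD; last by lia.
  by have := @qpoch_stable 1 K (s.*2 + i + (K + K - i)); rewrite mul1r; apply; lia.
rewrite (_ : i%:Z + s.*2%:Z = (s.*2 + i)%N) /w; last by lia.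
have u2 := qpochq_unit (s.*2 + i).
move: eE u2; set c := qpoch q q (s.*2 + i); set b := qpoch _ _ (_ - _).
set X := qpoch _ _ i * _ * _ => eE u2; transitivity ((qpoch q q i)^-1 * X * b).
  rewrite eE; transitivity ((qpoch q q i)^-1 * X * b * (c / c)).
    by ring.
  by rewrite divrr ?mulr1.
by transitivity ((qpoch q q i)^-1 * X * b * (E / E));
  [rewrite divrr ?mulr1 | rewrite -/E; ring].
Qed.

(** Here (-1; q)_s / (-q; q)_s = 2 / (1 + q^s). The terms r and -r of [slater_sum] jointly supply 1
    + q^s with s = 2r. *)
Lemma bailey_sum_sym (s : nat) : (0 < s)%N ->
  (1 + q ^+ s) * bailey_sum s%:Z * qpoch q q K =
  2 * q ^+ 'C(s.+1, 2) * qpoch (- q) q K.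
Proof.
case: s => // s _; apply: (mulIr (qpochNq_unit s.+1)).
transitivity ((1 + q ^+ s.+1) * (bailey_sum s.+1 * qpoch q q K * qpoch (- q) q s.+1)).
  by ring.
rewrite bailey_sumE qpochN1 qpochSr mulNr -exprS; ring.
Qed.

(** Split N^2 = N(N+1)/2 + N(N-1)/2 and express the second power by the Bailey pair; (-q; q)_N
    cancels against (q; q)_(2N). *)
Lemma slater_term N : (N < K.*2.+1)%N ->
  q ^+ (N ^ 2) * qpoch (-1) q N =
  qpoch q q N * qpoch q (q ^+ 2) N * (qpoch (-1) q N * q ^+ 'C(N.+1, 2) *
     bsum K.*2.+1 (fun r => sg r * qz (r * r - r) * (w (N%:Z - 2 * r) * w (N%:Z + 2 * r)))).
Proof.
move=> NK; have := bailey_pair_even NK; set U := bsum _ _ => e.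
apply: (mulIr (qpochNq_unit N)).
transitivity (qpoch (-1) q N * q ^+ 'C(N.+1, 2) * (U * qpoch q q N.*2)).
  rewrite e (_ : N ^ 2 = 'C(N.+1, 2) + 'C(N, 2))%N ?exprD; first by ring.
  by clear; rewrite binS bin1; elim: N => // N IHN; rewrite binS bin1 -!mulnn in IHN *; lia.
rewrite qpoch_double; ring.
Qed.

Variable a : nat -> A.
Hypothesis aE : forall N,
  a N * (qpoch q q N * qpoch q (q ^+ 2) N) = q ^+ (N ^ 2) * qpoch (-1) q N.

(** After exchanging sums, the inner one is [bailey_sum (2 * r)]. For r > 0 the terms r and -r
    combine by [bailey_sum_sym], with exponent r^2 - r + r(2r+1) = 3r^2. *)
Lemma slater_sum :
  (\sum_(N < K) a N) * qpoch q q K =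
  qpoch (- q) q K * bsum K.*2.+1 (fun r => sg r * q ^+ (3 * `|(r * r)%R|%N)).
Proof.
have aE' N : (N < K.*2.+1)%N -> a N = qpoch (-1) q N * q ^+ 'C(N.+1, 2) *
     bsum K.*2.+1 (fun r => sg r * qz (r * r - r) * (w (N%:Z - 2 * r) * w (N%:Z + 2 * r))).
  move=> NK; have uq2 : qpoch q (q ^+ 2) N \is a GRing.unit.
    by have := qpochq_unit N.*2; rewrite qpoch_double unitrM => /andP[].
  apply: (mulIr (_ : qpoch q q N * qpoch q (q ^+ 2) N \is a GRing.unit)).
    by rewrite unitrM qpochq_unit.
  by rewrite aE slater_term // mulrC.
have -> : \sum_(N < K) a N =
    bsum K.*2.+1 (fun r => sg r * qz (r * r - r) * bailey_sum (2 * r)).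
  transitivity (\sum_(N < K) bsum K.*2.+1 (fun r =>
      qpoch (-1) q N * q ^+ 'C(N.+1, 2) *
      (sg r * qz (r * r - r) * (w (N%:Z - 2 * r) * w (N%:Z + 2 * r))))).
    by apply: eq_bigr => N _; rewrite bsum_distrr aE'//; have := ltn_ord N; lia.
  rewrite /bsum exchange_big; apply: eq_bigr => r _ /=.
  by rewrite big_split !mulr_sumr; congr (_ + _); apply: eq_bigr => N _; ring.
rewrite !bsum_center; first last.
- by rewrite [qz _]qX0 ?mulr0 ?mul0r //; nia.
- by rewrite [q ^+ _]qX0 ?mulr0 //; nia.
rewrite mulrDl mulrDr; congr (_ + _).
  have := bailey_sumE 0; rewrite !qpoch0 mulr1 bin_small // expr0 !mul1r => e.
  by rewrite mulr0 mulr1.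
rewrite mulr_suml mulr_sumr; apply: eq_bigr => r _.
rewrite [2 * - _]mulrN bailey_sumN sg_opp mulrNN opprK.
rewrite (_ : 2 * r.+1%:Z = r.+1.*2%:Z); last by lia.
have := @bailey_sum_sym r.+1.*2 isT; set B := bailey_sum _ => e.
rewrite (_ : qz (r.+1%:Z * r.+1%:Z + r.+1%:Z) =
             qz (r.+1%:Z * r.+1%:Z - r.+1%:Z) * q ^+ r.+1.*2); last first.
  by rewrite /qz -exprD; congr (_ ^+ _); lia.
transitivity (sg r.+1%:Z * qz (r.+1%:Z * r.+1%:Z - r.+1%:Z) *
   ((1 + q ^+ r.+1.*2) * B * qpoch q q K)); first by ring.
rewrite e (_ : q ^+ (3 * _) = qz (r.+1%:Z * r.+1%:Z - r.+1%:Z) * q ^+ 'C(r.+1.*2.+1, 2)).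
  by ring.
rewrite /qz -exprD; congr (_ ^+ _); rewrite bin2 succnK -doubleMr doubleK.
by nia.
Qed.

End NilpotentBase.

(** * From the theta series to the product over non-multiples of 3 *)

Section ProductSide.
Variables (A : comUnitRingType) (q : A) (K : nat).
Hypothesis qK : q ^+ K = 0.

Lemma qpoch_split3 (c : A) :
  qpoch (c * q) q K =
  (\prod_(k < K | ~~ (3 %| k)%N) (1 - c * q ^+ k)) *
  qpoch (c * q ^+ 3) (q ^+ 3) K.
Proof.
pose f k := if (3 %| k)%N then 1 else 1 - c * q ^+ k.
(* Exact for 3n factors; index 0 is harmless because 3 divides 0 makes [f 0] equal to 1. *)
have exact3 n : qpoch (c * q) q (3 * n) =
    (\prod_(k < (3 * n).+1) f k) * qpoch (c * q ^+ 3) (q ^+ 3) n.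
  elim: n => [|n IHn].
    by rewrite muln0 big_ord_recr big_ord0 !qpoch0 /f /= !mulr1.
  rewrite (_ : 3 * n.+1 = (3 * n).+3)%N; last by lia.
  have f1 : f (3 * n).+1 = 1 - c * q ^+ (3 * n).+1.
    by rewrite /f ifF //; apply/negP; lia.
  have f2 : f (3 * n).+2 = 1 - c * q ^+ (3 * n).+2.
    by rewrite /f ifF //; apply/negP; lia.
  have f3 : f (3 * n).+3 = 1 by rewrite /f ifT //; lia.
  rewrite !qpochSr IHn [in RHS]big_ord_recr [in RHS]big_ord_recr [in RHS]big_ord_recr /=.
  rewrite f1 f2 f3.
  rewrite -exprM !exprS; ring.
rewrite (@qpoch_stable _ q K qK c K (3 * K)) ?exact3 //; last by lia.
congr (_ * _); rewrite (_ : (3 * K).+1 = K + (2 * K).+1)%N; last by lia.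
rewrite big_split_ord /= [X in _ * X]big1 ?mulr1 => [|i _]; last first.
  by rewrite /f; case: ifP => // _; rewrite (qX0 qK) ?mulr0 ?subr0 //; lia.
by rewrite [RHS]big_mkcond; apply: eq_bigr => i _; rewrite /f; case: (3 %| i)%N.
Qed.

Variables a P : nat -> A.
Hypothesis aE : forall N,
  a N * (qpoch q q N * qpoch q (q ^+ 2) N) = q ^+ (N ^ 2) * qpoch (-1) q N.
Hypothesis PE : forall k, ~~ (3 %| k)%N -> P k * (1 - q ^+ k) = 1 + q ^+ k.

(** Gauss in base q^3 evaluates the theta series; [qpoch_split3] at c = 1 and c = -1 then cancels
    the factors at multiples of 3. *)
Lemma slater_identity :
  \sum_(N < K) a N = \prod_(k < K | ~~ (3 %| k)%N) P k.
Proof.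
have q3K : (q ^+ 3) ^+ K = 0 by rewrite exprAC qK expr0n.
have gauss := gauss_theta q3K.
have uq := qpochq_unit qK K; have uN3 := qpochNq_unit q3K K.
apply: (mulIr uq); apply: (mulIr uN3).
rewrite (slater_sum qK aE).
rewrite (_ : bsum _ _ = bsum K.*2.+1 (fun r => sg A r * qz (q ^+ 3) (r * r))).
  2: by apply: eq_bsum => r; rewrite exprM.
rewrite -[LHS]mulrA gauss.
have := qpoch_split3 1; have := qpoch_split3 (-1).
rewrite !mul1r !mulN1r => -> ->.
have -> : \prod_(k < K | ~~ (3 %| k)%N) (1 - -1 * q ^+ k) =
          (\prod_(k < K | ~~ (3 %| k)%N) P k) *
          \prod_(k < K | ~~ (3 %| k)%N) (1 - 1 * q ^+ k).
  rewrite -big_split; apply: eq_bigr => k k3 /=.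
  by rewrite mul1r PE // mulN1r opprK.
ring.
Qed.

End ProductSide.

(** * Generating functions *)

Section GeneratingFunctions.
Variables (A : comUnitRingType) (q : A) (m : nat).
Hypothesis qm : q ^+ m.+1 = 0.

(** The truncation of (1 + x) / (1 - x): a positive multiplicity carries two choices of flag. *)
Let geo (x : A) : A := \sum_(d < m.+1) x ^+ d *+ (if d == 0 :> nat then 1 else 2).

Lemma expr_nil k : (0 < k)%N -> (q ^+ k) ^+ m.+1 = 0.
Proof. by case: k => // k _; rewrite exprAC qm expr0n. Qed.

Lemma geo_sum k : (0 < k)%N -> (\sum_(d < m.+1) q ^+ k ^+ d) * (1 - q ^+ k) = 1.
Proof.
move=> k0; have := subrX1 (q ^+ k) m.+1; rewrite expr_nil // sub0r.
by rewrite -[_ - 1]opprB mulNr => /oppr_inj; rewrite mulrC.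
Qed.

Lemma geoE k : (0 < k)%N -> geo (q ^+ k) * (1 - q ^+ k) = 1 + q ^+ k.
Proof.
move=> k0; have e := geo_sum k0.
have -> : geo (q ^+ k) = 2 * (\sum_(d < m.+1) q ^+ k ^+ d) - 1.
  rewrite /geo !big_ord_recl /= expr0 mulr1n.
  under eq_bigr => i _ do rewrite mulr2n -mulr2n -mulr_natl.
  by rewrite -mulr_sumr; ring.
by rewrite mulrBl -mulrA e; ring.
Qed.

Lemma code_weight_cons x h : code_weight (x :: h) =
  ((size h).*2.+1 * x.1.1 + (size h).+1 * x.1.2 + code_weight h)%N.
Proof. by case: x => [[j d] b]. Qed.

Definition codes_gf fst N : A := \sum_(h <- codes m fst N) q ^+ code_weight h.

(** The first entry precedes [N] others, so [j] and [d] range over geometric series in q^(2N+1) and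
    q^(N+1). The value d = 0 has two flags only for the smallest part, whence 2 against 1 +
    q^(N+1). *)
Lemma codes_gfS fst N : codes_gf fst N.+1 * ((1 - q ^+ N.*2.+1) * (1 - q ^+ N.+1)) =
  q ^+ N.*2.+1 * (if fst then 2 else 1 + q ^+ N.+1) * codes_gf false N.
Proof.
have -> : codes_gf fst N.+1 =
    (\sum_(x <- entries m fst) q ^+ (N.*2.+1 * x.1.1) * q ^+ (N.+1 * x.1.2)) *
    codes_gf false N.
  rewrite /codes_gf /= big_allpairs_dep mulr_suml; apply: eq_bigr => x _.
  rewrite mulr_sumr; apply: eq_big_seq => h.
  rewrite mem_codes => /and3P[/eqP hN _ _].
  by rewrite code_weight_cons hN !exprD.
have -> : \sum_(x <- entries m fst) q ^+ (N.*2.+1 * x.1.1) * q ^+ (N.+1 * x.1.2) =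
    (\sum_(j <- iota 1 m) q ^+ (N.*2.+1 * j)) *
    (\sum_(d < m.+1) q ^+ N.+1 ^+ d *+ size (flags fst d)).
  rewrite big_allpairs_dep big_allpairs_dep mulr_suml; apply: eq_bigr => j _.
  rewrite mulr_sumr -[iota 0 m.+1]/(index_iota 0 m.+1) big_mkord.
  apply: eq_bigr => d _ /=.
  by rewrite big_const_seq count_predT iter_addr_0 -exprM mulrnAr.
have jE : (\sum_(j <- iota 1 m) q ^+ (N.*2.+1 * j)) * (1 - q ^+ N.*2.+1) = q ^+ N.*2.+1.
  have -> : \sum_(j <- iota 1 m) q ^+ (N.*2.+1 * j) =
            (\sum_(d < m.+1) q ^+ N.*2.+1 ^+ d) - 1.
    have -> : iota 1 m = index_iota 1 m.+1 by rewrite /index_iota subSS subn0.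
    rewrite -(big_mkord xpredT (fun d => q ^+ N.*2.+1 ^+ d)).
    rewrite [in RHS]big_ltn // addrAC expr0 subrr add0r.
    by apply: eq_bigr => j _; rewrite exprM.
  by rewrite mulrBl geo_sum // mul1r opprB addrC subrK.
have dE : (\sum_(d < m.+1) q ^+ N.+1 ^+ d *+ size (flags fst d)) * (1 - q ^+ N.+1) =
    (if fst then 2 else 1 + q ^+ N.+1).
  case: fst; last first.
    rewrite -geoE //; congr (_ * _); apply: eq_bigr => d _.
    by rewrite /flags /=; case: eqP.
  rewrite /flags /=; under eq_bigr => d _ do rewrite -mulr_natl.
  by rewrite -mulr_sumr -mulrA geo_sum // mulr1.
rewrite -[in RHS]dE -[in RHS]jE; ring.
Qed.

Lemma codes_gf0 fst : codes_gf fst 0 = 1.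
Proof. by rewrite /codes_gf big_seq1 expr0. Qed.

(** The odd exponents 2N + 1 add up to a square. *)
Lemma codes_gf_false N : codes_gf false N * (qpoch q q N * qpoch q (q ^+ 2) N) =
  q ^+ (N ^ 2) * qpoch (- q) q N.
Proof.
elim: N => [|N IHN]; first by rewrite codes_gf0 !qpoch0 expr0 !mulr1.
rewrite !qpochSr -!exprM -!exprS mul2n.
transitivity (codes_gf false N.+1 * ((1 - q ^+ N.*2.+1) * (1 - q ^+ N.+1)) *
   (qpoch q q N * qpoch q (q ^+ 2) N)); first by ring.
rewrite codes_gfS -mulrA IHN (_ : N.+1 ^ 2 = N.*2.+1 + N ^ 2)%N; last by rewrite -!mulnn; lia.
by rewrite exprD mulNr -exprS; ring.
Qed.

(** The smallest part contributes the factor 2, and 2 (-q; q)_N = (-1; q)_(N+1). *)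
Lemma codes_gf_true N : codes_gf true N * (qpoch q q N * qpoch q (q ^+ 2) N) =
  q ^+ (N ^ 2) * qpoch (-1) q N.
Proof.
case: N => [|N]; first by rewrite codes_gf0 !qpoch0 expr0 !mulr1.
rewrite qpochN1 !qpochSr -!exprM -!exprS mul2n.
transitivity (codes_gf true N.+1 * ((1 - q ^+ N.*2.+1) * (1 - q ^+ N.+1)) *
   (qpoch q q N * qpoch q (q ^+ 2) N)); first by ring.
rewrite codes_gfS -mulrA codes_gf_false (_ : N.+1 ^ 2 = N.*2.+1 + N ^ 2)%N.
  by rewrite exprD; ring.
by rewrite -!mulnn; lia.
Qed.

(** When 3 divides [k], and so at [k = 0], only multiplicity 0 without overline remains. *)
Definition J_factor (k : nat) : A :=
  \sum_(c : 'I_m.+1 * bool | (c.2 ==> (0 < c.1)%N) && ((0 < c.1)%N ==> ~~ (3 %| k)%N))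
     q ^+ (k * c.1).

Lemma J_factorE k : ~~ (3 %| k)%N -> J_factor k * (1 - q ^+ k) = 1 + q ^+ k.
Proof.
move=> k3; rewrite -geoE; last by case: k k3.
congr (_ * _); rewrite /J_factor k3.
rewrite big_mkcond -(pair_bigA _ (fun (d : 'I_m.+1) (b : bool) =>
  if (b ==> (0 < d)%N) && ((0 < d)%N ==> true) then q ^+ (k * d) else 0)) /=.
apply: eq_bigr => d _; rewrite big_bool /= implybT exprM.
by case: (nat_of_ord d) => [|n] /=; rewrite ?add0r ?mulr2n.
Qed.

Lemma J_factor3 k : (3 %| k)%N -> J_factor k = 1.
Proof.
move=> k3; rewrite /J_factor k3 (big_pred1 (ord0, false)) ?muln0 //.
by case=> [[[|d] ?] []]; rewrite /= ?xpair_eqE ?andbF.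
Qed.

Lemma generating_functions :
  \sum_(N < m.+1) codes_gf true N = \prod_(k < m.+1) J_factor k.
Proof.
rewrite (slater_identity qm codes_gf_true J_factorE).
rewrite [RHS](bigID (fun k : 'I__ => 3 %| k)%N) /=.
by rewrite [X in _ = X * _]big1 ?mul1r // => k /J_factor3.
Qed.

End GeneratingFunctions.

(** * Polynomials modulo X^(m+1) as the ring with nilpotent base *)

Section TruncatedPolynomials.
Variable m : nat.

Local Notation B := {poly %/ ('X^(m.+1) : {poly rat})}.

Definition truncX : {rmorphism {poly rat} -> B} := in_qpoly ('X^(m.+1) : {poly rat}).

Lemma truncX_nil : truncX 'X ^+ m.+1 = 0.
Proof.
rewrite -rmorphXn; apply: val_inj => /=.
by rewrite mk_monic_Xn Pdiv.RingMonic.rmodpp ?monicXn.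
Qed.

(** Reduction subtracts a multiple of X^(m+1), which has no term in degree [m]. *)
Lemma truncX_coef p p' : truncX p = truncX p' -> p`_m = p'`_m.
Proof.
have mon : ('X^(m.+1) : {poly rat}) \is monic by exact: monicXn.
move/(congr1 val) => /=; rewrite mk_monic_Xn => e.
have coefE (r : {poly rat}) : r`_m = (Pdiv.Ring.rmodp r 'X^(m.+1))`_m.
  by rewrite [in LHS](Pdiv.RingMonic.rdivp_eq mon r) coefD coefMXn ltnSn add0r.
by rewrite coefE e -coefE.
Qed.

End TruncatedPolynomials.

(** Distributivity turns the product into one monomial per choice function [f], of degree the sum of
    its parts. *)
Lemma J_coef (m : nat) :
  (J m)%:R = (\prod_(k < m.+1) J_factor ('X : {poly rat}) m k)`_m.
Proof.
rewrite /J_factor bigA_distr_big_dep coef_sum /J -sum1_card natr_sum.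
transitivity (\sum_(f in family (fun k : 'I_m.+1 => [pred c : 'I_m.+1 * bool |
    (c.2 ==> (0 < c.1)%N) && ((0 < c.1)%N ==> ~~ (3 %| k)%N)]) |
    m == (\sum_(k < m.+1) k * (f k).1)%N) (1 : rat)); last first.
  rewrite big_mkcondr; apply: eq_bigr => f _.
  by rewrite -expr_sum coefXn; case: eqP.
apply: eq_bigl => f; rewrite inE.
apply/andP/andP => [[/and3P[_ /eqP fm /forallP f2] /forallP f3]|[/familyP ff /eqP fm]].
  by split; [apply/familyP => k; rewrite inE f2 f3 | rewrite fm].
split; last by apply/forallP => k; have := ff k; rewrite inE => /andP[].
apply/and3P; split; [|by rewrite -fm|].
  (* Multiplicity 0 at size 0 comes from the condition on multiples of 3. *)
  by have := ff ord0; rewrite inE => /andP[_]; rewrite dvdn0 implybF -leqNgt leqn0.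
by apply/forallP => k; have := ff k; rewrite inE => /andP[].
Qed.

Lemma L_coef (m : nat) : (0 < m)%N ->
  (L m)%:R = (\sum_(N < m.+1) codes_gf ('X : {poly rat}) m true N)`_m.
Proof.
move=> m0; rewrite L_codes // natr_sum coef_sum; apply: eq_bigr => N _.
rewrite /codes_gf coef_sum -sum1_count natr_sum big_mkcond.
by apply: eq_bigr => h _; rewrite coefXn eq_sym; case: eqP.
Qed.

Theorem theorem30 (m : nat) : (1 <= m)%N -> J m = L m.
Proof.
move=> m0; apply/eqP; rewrite -(eqr_nat rat) J_coef L_coef //; apply/eqP.
apply: truncX_coef; rewrite rmorph_prod rmorph_sum.
(* Both sides are built from finite sums of powers of the base, so the morphism just replaces X by
   its class. *)
transitivity (\prod_(k < m.+1) J_factor (truncX m 'X) m k).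
  apply: eq_bigr => k _; rewrite /J_factor rmorph_sum.
  by apply: eq_bigr => c _; rewrite rmorphXn.
rewrite -(generating_functions (truncX_nil m)); apply: eq_bigr => N _.
by rewrite /codes_gf rmorph_sum; apply: eq_bigr => h _; rewrite rmorphXn.
Qed.
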